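(* For every integer $n\ge 1$, the number of tieless parking functions $\rho$ of length $n$ with exactly $1$ descent (equivalently, with exactly $n-2$ descents) is $$C_{n+1}-\binom{n+1}{2}-1,$$ where $C_{n+1}=\frac{1}{n+2}\binom{2n+2}{n+1}$ is the $(n+1)$th Catalan number.
   Context: Notation: $[n]=\{1,\dots,n\}$. A parking function of length $n$ is a function $\rho:[n]\to[n]$, identified with the tuple $(\rho_1,\dots,\rho_n)$, such that $\#\rho^{-1}([k])\ge k$ for all $1\le k\le n$. It is tieless if $\rho_i\ne\rho_{i+1}$ for all $i\in[n-1]$. A descent of $\rho$ is an index $i\in[n-1]$ with $\rho_i>\rho_{i+1}$. The word ''equivalently'' means that the number of tieless parking functions of length $n$ with exactly $n-2$ descents is given by the same formula. *)

(* Defs.v *)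
From mathcomp Require Import all_boot all_order all_algebra.

Set Implicit Arguments.
Unset Strict Implicit.
Unset Printing Implicit Defensive.

Import Order.TTheory GRing.Theory Num.Theory.

Local Open Scope ring_scope.

(* The set [n] = {1, ..., n} is represented by 'I_n = {0, ..., n-1}: both
   positions and values are shifted down by one.  In particular the paper's
   initial segment [k+1] corresponds to the j : 'I_n with j <= k, so k : 'I_n
   below ranges over the paper's 1 <= k+1 <= n. *)
Definition parking n (rho : {ffun 'I_n -> 'I_n}) : bool :=
  [forall k : 'I_n, (k.+1 <= #|rho @^-1: [set j : 'I_n | (j <= k)%N]|)%N].

Definition tieless n (rho : {ffun 'I_n -> 'I_n}) : bool :=
  [forall i : 'I_n, forall j : 'I_n,
     (j == i.+1 :> nat) ==> (rho i != rho j)].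

(* The last position has no successor j in 'I_n, hence is never a descent. *)
Definition descents n (rho : {ffun 'I_n -> 'I_n}) : {set 'I_n} :=
  [set i : 'I_n | [exists j : 'I_n,
     (j == i.+1 :> nat) && (rho j < rho i)%N]].

(* The number of descents is prescribed by an integer, so that d = n - 2 is
   meaningful (and gives the empty set) when n = 1. *)
Definition tieless_parking_des n (d : int) : {set {ffun 'I_n -> 'I_n}} :=
  [set rho | [&& parking rho, tieless rho & #|descents rho|%:Z == d]].

Definition catalan (m : nat) : rat := 'C(m.*2, m)%:R / m.+1%:R.

(* Main.v *)
Require Import Defs.
From mathcomp Require Import all_boot all_order all_algebra zify ring.

Set Implicit Arguments.
Unset Strict Implicit.
Unset Printing Implicit Defensive.

Import Order.TTheory GRing.Theory Num.Theory.

Local Open Scope nat_scope.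

(** A tieless function with exactly one descent is the concatenation of two
    nonempty strictly increasing runs, hence is given by its pair (A, B) of
    value sets, subject to the condition that the concatenation is not weakly
    increasing.  Such a pair is a word of length n over the four letters
    (v \in A, v \in B), one for each value v.  Reading the letter (a, b) as a
    step of height a + b - 1, the parking condition together with
    |A| + |B| = n says exactly that the word is a bicoloured Motzkin path: it
    stays nonnegative and returns to 0 ([motzkin_parking]).

    There are C_{n+1} bicoloured Motzkin paths of length n.  More generally,
    the number of those that start at height h is
    'C(2n, n + h) - 'C(2n, n + h + 2) ([nb_motzkin]), by induction on n after
    removing the first letter; for h = 0 this is the Catalan number
    ([catalanE]).

    The words to discard are those whose two runs concatenate to a weakly
    increasing sequence.  There are 'C(n + 1, 2) + 1 of them
    ([nb_motzkin_sorted]): such a word begins with a possibly empty block of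
    letters (1, 0), and the next letter finishes the first run.  If that letter
    is (0, 1), all later letters are (0, 1) as well; if it is (1, 1), exactly
    one later letter is (0, 0), in an arbitrary position, and the others are
    (0, 1).

    Finally, reading a function backwards preserves the parking and tieless
    conditions and turns d descents into n - 1 - d descents, which gives the
    statement about n - 2 descents. *)

(** * Words over pairs of bits *)

Notation letter := (bool * bool)%type.

(** [motzkin h w]: starting at height [h], with the letter [(a, b)] read as a
    step [a + b - 1], the path [w] never goes below 0 and ends at height 0.  The
    test on [h + a + b] precedes the decrement because the predecessor is
    truncated at 0. *)
Fixpoint motzkin (h : nat) (w : seq letter) : bool :=
  if w is x :: w' then (0 < h + x.1 + x.2) && motzkin (h + x.1 + x.2).-1 w'
  else h == 0.

(** The increasing sequence of the [k + i] such that the [i]-th bit is set. *)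
Definition run (b : seq bool) (k : nat) : seq nat := mask b (iota k (size b)).

(** The concatenation of the two runs coded by a word; the letter in position
    [i] tells which of the two runs contains the value [k + i]. *)
Definition two_runs (k : nat) (w : seq letter) : seq nat :=
  run (unzip1 w) k ++ run (unzip2 w) k.

(** The number of words of length [n] that satisfy [P]. *)
Definition nb_words n (P : pred (seq letter)) : nat :=
  #|[set w : n.-tuple letter | P w]|.

Lemma eq_nb_words n (P Q : pred (seq letter)) :
  P =1 Q -> nb_words n P = nb_words n Q.
Proof. by move=> eqPQ; apply: eq_card => w; rewrite !inE eqPQ. Qed.

Lemma nb_words_pred0 n : nb_words n xpred0 = 0.
Proof. by apply: eq_card0 => w; rewrite inE. Qed.

Lemma nb_words_split n (P Q : pred (seq letter)) :
  nb_words n (fun w => P w && Q w) + nb_words n (fun w => P w && ~~ Q w) =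
  nb_words n P.
Proof.
rewrite /nb_words -(cardsID [set w : n.-tuple letter | Q w]
  [set w : n.-tuple letter | P w]).
by congr (_ + _); apply: eq_card => w; rewrite !inE // andbC.
Qed.

Lemma nb_words0 P : nb_words 0 P = P [::].
Proof.
rewrite /nb_words -sum1_card (eq_bigl (fun w => P [::])); last first.
  by move=> w; rewrite inE (tuple0 w).
by case: (P [::]); rewrite ?big_pred0_eq // sum1_card card_tuple expn0.
Qed.

Lemma nb_wordsS n P :
  nb_words n.+1 P =
  nb_words n (fun w => P ((false, false) :: w)) +
  nb_words n (fun w => P ((false, true) :: w)) +
  nb_words n (fun w => P ((true, false) :: w)) +
  nb_words n (fun w => P ((true, true) :: w)).
Proof.
have sum_letter (F : letter -> nat) : \sum_x F x =
    F (false, false) + F (false, true) + F (true, false) + F (true, true).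
  rewrite (eq_bigr (fun x => F (x.1, x.2))) => [|[a b] _ //].
  by rewrite -(pair_bigA _ (fun a b => F (a, b))) /= !big_bool /=; ring.
rewrite -(sum_letter (fun x => nb_words n (fun w => P (x :: w)))).
rewrite /nb_words -sum1_card.
rewrite (reindex (fun p : letter * n.-tuple letter =>
  [tuple of p.1 :: p.2])) /=; last first.
  exists (fun w : n.+1.-tuple letter => (thead w, [tuple of behead w])).
    by move=> [x w] _ /=; congr (_, _); apply: val_inj.
  by move=> w _ /=; rewrite -tuple_eta.
rewrite (eq_bigr (fun x => \sum_(w : n.-tuple letter | P (x :: w)) 1)).
  by rewrite pair_big_dep /=; apply: eq_bigl => -[x w]; rewrite inE.
by move=> x _; rewrite -sum1_card; apply: eq_bigl => w; rewrite inE.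
Qed.

(** * Counting bicoloured Motzkin paths *)

Lemma bin_double_rec n k :
  'C(n.+1.*2, k.+2) = 'C(n.*2, k.+2) + ('C(n.*2, k.+1)).*2 + 'C(n.*2, k).
Proof. rewrite doubleS !binS; lia. Qed.

Lemma bin_double_sym n : 'C(n.+1.*2, n) = 'C(n.+1.*2, n.+2).
Proof.
have le_n : n <= n.+1.*2 by lia.
by rewrite -(bin_sub le_n) (_ : n.+1.*2 - n = n.+2) //; lia.
Qed.

(** The ballot formula, stated additively.  Writing it with [n + h] rather than
    [n - h] avoids truncated subtraction; the symmetry of the binomial
    coefficients provides the boundary case [h = 0] of the induction. *)
Lemma nb_motzkin n h :
  nb_words n (fun w => motzkin h w) + 'C(n.*2, (n + h).+2) = 'C(n.*2, n + h).
Proof.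
elim: n h => [|n IHn] h; first by rewrite nb_words0 add0n !bin0n /= addn0.
rewrite nb_wordsS /= !addn0 !addn1 /=.
have := IHn h.+1; have := IHn h.
rewrite !addSn addnS !bin_double_rec.
case: h => [|h] /=.
  rewrite nb_words_pred0 addn0 add0n.
  case: n {IHn} => [|n].
    by rewrite double0 (_ : 'C(1.*2, 1) = 2) // !bin0n /=; lia.
  have := bin_double_rec n.+1 n.
  by rewrite (bin_double_sym n); lia.
by have := IHn h; rewrite !addnS !bin_double_rec; lia.
Qed.

(** When the first run is empty, every step is 0 or -1, so the path is given by
    the positions of its [h] down steps. *)
Lemma nb_motzkin_only_snd n h :
  nb_words n (fun w => motzkin h w && ~~ has fst w) = 'C(n, h).
Proof.
elim: n h => [|n IHn] h; first by rewrite nb_words0 /= andbT bin0n.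
rewrite nb_wordsS /= !addn0 !addn1 /= IHn.
rewrite ![nb_words n (fun w => _ && false)](eq_nb_words _ (Q := xpred0)); last first.
- by move=> w; rewrite andbF.
- by move=> w; rewrite andbF.
rewrite nb_words_pred0 !addn0.
case: h => [|h] /=; last by rewrite IHn binS addnC.
by rewrite nb_words_pred0 !bin0.
Qed.

(** * Words whose two runs concatenate to a sorted sequence *)

Lemma run_cons a b k : run (a :: b) k = nseq a k ++ run b k.+1.
Proof. by rewrite /run /=; case: a. Qed.

Lemma run_ge b k : all (leq k) (run b k).
Proof.
apply/allP => x /mem_mask; rewrite mem_iota; by case/andP.
Qed.

Lemma run_sorted b k : sorted ltn (run b k).
Proof. by apply: sorted_mask; [exact: ltn_trans | exact: iota_ltn_sorted]. Qed.

Lemma size_run b k : size (run b k) = count id b.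
Proof. by rewrite size_mask // size_iota. Qed.

Lemma path_leq_ge k s : all (leq k) s -> path leq k s = sorted leq s.
Proof. by case: s => //= x s /andP[-> _]. Qed.

(** If the second run contains the least value [k] and the first does not, then
    the concatenation is sorted exactly when the first run is empty. *)
Lemma sorted_two_runs_insert b c k :
  sorted leq (run b k.+1 ++ k :: run c k.+1) = ~~ has id b.
Proof.
rewrite has_count -(size_run b k.+1) -leqNgt leqn0 size_eq0.
have := run_ge b k.+1; have := run_sorted c k; have := run_ge c k.+1.
case: (run b k.+1) => [|x r] /= Hc _ Hb.
  rewrite path_leq_ge; last by apply: sub_all Hc => y /ltnW.
  by apply: sub_sorted (run_sorted c k.+1) => y z /ltnW.
apply/negP; rewrite cat_path /= => /and3P[Hp Hl _].
have := allP (Hb : all (leq k.+1) (x :: r)) _ (mem_last x r).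
by rewrite /= ltnNge Hl.
Qed.

(** The induction is on the first letter.  Starting at height 0, the letter
    (0, 0) is impossible, (1, 0) leaves the condition unchanged, and (0, 1) and
    (1, 1) force the rest of the first run to be empty, with remaining height 0
    and 1 respectively. *)
Lemma nb_motzkin_sorted n k :
  nb_words n (fun w => motzkin 0 w && sorted leq (two_runs k w))
  = 'C(n.+1, 2) + 1.
Proof.
elim: n k => [|n IHn] k; first by rewrite nb_words0.
have le_k w : all (leq k) (two_runs k.+1 w).
  by rewrite all_cat; apply/andP; split; apply: sub_all (run_ge _ _) => y /ltnW.
rewrite nb_wordsS /= nb_words_pred0 add0n.
rewrite [X in X + _ + _](eq_nb_words _
    (Q := fun w => motzkin 0 w && ~~ has fst w)); last first.
  by move=> w; rewrite /two_runs !run_cons sorted_two_runs_insert has_map.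
rewrite [X in _ + X + _](eq_nb_words _
    (Q := fun w => motzkin 0 w && sorted leq (two_runs k.+1 w))); last first.
  by move=> w; rewrite /two_runs !run_cons /= path_leq_ge ?le_k.
rewrite [X in _ + X](eq_nb_words _
    (Q := fun w => motzkin 1 w && ~~ has fst w)); last first.
  move=> w; rewrite /two_runs !run_cons /= path_leq_ge.
    by rewrite sorted_two_runs_insert has_map.
  have := le_k w; rewrite !all_cat => /andP[-> Hb] /=.
  by rewrite leqnn.
rewrite IHn !nb_motzkin_only_snd bin0 bin1 [in RHS]binS bin1; lia.
Qed.

(** * Motzkin paths and the parking condition *)

(** The global description of a path: at every time [k] the height
    (the initial height, plus the number of bits read, minus [k]) is nonnegative,
    and it is 0 at the end. *)
Lemma motzkinP h w :
  reflect (h + count fst w + count snd w = size w /\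
    forall k, k <= size w -> k <= h + count fst (take k w) + count snd (take k w))
   (motzkin h w).
Proof.
elim: w h => [|[a b] w IHw] h /=.
  by apply: (iffP eqP) => [->|[]]; [split=> // k; rewrite leqn0 => /eqP->| lia].
apply: (iffP andP) => [[H /IHw [Hs Hk]]|[Hs Hk]].
  split; first by lia.
  by case=> [|k] // /Hk /=; lia.
have := Hk 1 isT; rewrite /= take0 /= => H; split; first by lia.
apply/IHw; split; first by lia.
by move=> k Hks; have := Hk k.+1 Hks; rewrite /=; lia.
Qed.

Lemma count_run b j k : count (fun x => x < j + k) (run b j) = count id (take k b).
Proof.
elim: b j k => [|a b IHb] j [|k] //=; rewrite run_cons count_cat.
  rewrite (_ : count _ (nseq a j) = 0); last by rewrite count_nseq addn0 ltnn.
  rewrite addn0; apply/eqP; rewrite -leqn0 leqNgt -has_count.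
  apply/hasPn => x /(allP (run_ge _ _)); lia.
by rewrite -addSnnS IHb count_nseq; case: a => //=; lia.
Qed.

(** The parking condition, with values counted from 0, for the sequence of
    values of a function. *)
Definition parking_word n (s : seq nat) : bool :=
  (size s == n) && all (fun k => k < count (geq k) s) (iota 0 n).

Lemma motzkin_parking w : motzkin 0 w = parking_word (size w) (two_runs 0 w).
Proof.
have cnt k : count (fun x => x < k) (two_runs 0 w) =
  count fst (take k w) + count snd (take k w).
  by rewrite count_cat -[k in LHS]add0n !count_run -!map_take !count_map.
apply/motzkinP/andP => [[Hs Hk]|[/eqP Hs /allP Hk]].
  rewrite size_cat !size_run !count_map Hs eqxx; split=> //.
  apply/allP => k; rewrite mem_iota /= add0n => /Hk.
  by rewrite add0n -cnt; congr (_ < _); apply: eq_count => x /=; rewrite ltnS.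
split; first by rewrite -Hs size_cat !size_run !count_map.
case=> [|k] // Hks; rewrite add0n -cnt.
have := Hk k; rewrite mem_iota /= add0n => /(_ Hks).
by congr (_ < _); apply: eq_count => x /=; rewrite ltnS.
Qed.

(** * Functions as sequences of values *)

Section FunctionWords.

Variable n : nat.
Implicit Type rho : {ffun 'I_n -> 'I_n}.

(** The sequence of values of [rho]. *)
Definition ffun_word rho : seq nat := [seq val (rho i) | i <- enum 'I_n].

(** The function with a given sequence of values.  The default value [i] is only
    used when an entry of [s] is not less than [n]. *)
Definition ffun_of_word (s : seq nat) : {ffun 'I_n -> 'I_n} :=
  [ffun i : 'I_n => insubd i (nth 0 s i)].

Lemma size_ffun_word rho : size (ffun_word rho) = n.
Proof. by rewrite size_map size_enum_ord. Qed.

Lemma nth_ffun_word rho (i : 'I_n) : nth 0 (ffun_word rho) i = rho i.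
Proof. by rewrite (nth_map i) ?size_enum_ord // nth_ord_enum. Qed.

Lemma ffun_word_lt rho : all (gtn n) (ffun_word rho).
Proof. by apply/allP => x /mapP[i _ ->] /=. Qed.

Lemma ffun_wordK : cancel ffun_word ffun_of_word.
Proof.
by move=> rho; apply/ffunP => i; rewrite ffunE nth_ffun_word valKd.
Qed.

Lemma ffun_of_wordK s :
  size s = n -> all (gtn n) s -> ffun_word (ffun_of_word s) = s.
Proof.
move=> sz lt_s; apply: (@eq_from_nth _ 0) => [|i]; rewrite size_ffun_word ?sz //.
move=> lt_in; rewrite (nth_ffun_word _ (Ordinal lt_in)) ffunE /= insubdK //.
by apply: (allP lt_s); rewrite mem_nth ?sz.
Qed.

Lemma parking_ffun_word rho : parking rho = parking_word n (ffun_word rho).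
Proof.
have cnt k : count (geq k) (ffun_word rho) =
    #|rho @^-1: [set j : 'I_n | j <= k]|.
  rewrite count_map cardE [in RHS]/enum_mem size_filter -enumT.
  apply: eq_count => i.
  by rewrite /= !inE.
rewrite /parking_word size_ffun_word eqxx /=.
apply/forallP/allP => [Hk k|Hk k].
  by rewrite mem_iota /= add0n => lt_kn; rewrite cnt; apply: (Hk (Ordinal lt_kn)).
by rewrite -cnt; apply: Hk; rewrite mem_iota /=.
Qed.

Lemma tielessP rho :
  reflect (forall i, i.+1 < n ->
             nth 0 (ffun_word rho) i <> nth 0 (ffun_word rho) i.+1)
          (tieless rho).
Proof.
apply: (iffP forallP) => [H i lt_in | H i].
  have /forallP/(_ (Ordinal lt_in)) := H (Ordinal (ltnW lt_in)).
  by rewrite /= eqxx /= -val_eqE /= -!nth_ffun_word /= => /eqP.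
apply/forallP => j; apply/implyP => /eqP def_j.
rewrite -val_eqE /= -!nth_ffun_word def_j; apply/eqP/H.
by rewrite -def_j.
Qed.

Lemma mem_descents rho (i : 'I_n) : (i \in descents rho) =
  (i.+1 < n) && (nth 0 (ffun_word rho) i.+1 < nth 0 (ffun_word rho) i).
Proof.
rewrite inE; apply/existsP/andP => [[j /andP[/eqP def_j]]|[lt_in]].
  by rewrite -!nth_ffun_word def_j -[in _ < n]def_j.
move=> H; exists (Ordinal lt_in); rewrite /= eqxx /=.
by rewrite -!nth_ffun_word.
Qed.

End FunctionWords.

(** * One descent means two increasing runs *)

(** [cut c s]: cutting [s] after its first [c] entries leaves two strictly
    increasing sequences. *)
Definition cut (c : nat) (s : seq nat) : bool :=
  sorted ltn (take c s) && sorted ltn (drop c s).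

Lemma cutP c s :
  reflect (forall j, j.+1 < size s -> j.+1 <> c -> nth 0 s j < nth 0 s j.+1)
    (cut c s).
Proof.
have [le_sc|lt_cs] := leqP (size s) c.
  rewrite /cut take_oversize // drop_oversize // andbT.
  apply: (iffP (sortedP 0)) => H j lt_j; first by move=> _; apply: H.
  by apply: H => // eq_jc; rewrite eq_jc ltnNge le_sc in lt_j.
apply: (iffP andP) => [[/(sortedP 0) H1 /(sortedP 0) H2] j lt_j ne_jc | H].
  have [lt_jc|le_cj] := ltnP j.+1 c.
    have := H1 j; rewrite size_take lt_cs => /(_ lt_jc).
    by rewrite !nth_take //; apply: ltnW.
  have le_cj' : c <= j by rewrite -ltnS ltn_neqAle le_cj andbT; apply/eqP => /esym.
  have := H2 (j - c); rewrite size_drop -subSn // ltn_sub2r // => /(_ isT).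
  by rewrite !nth_drop !subnKC.
split; apply/(sortedP 0) => j.
  rewrite size_take lt_cs => lt_jc; rewrite !nth_take //; last exact: ltnW.
  by apply: H; [exact: ltn_trans lt_cs | move=> eq_jc; rewrite eq_jc ltnn in lt_jc].
rewrite size_drop ltn_subRL addnS => lt_j; rewrite !nth_drop addnS.
by apply: H => // eq_jc; lia.
Qed.

Lemma unsortedP s : ~~ sorted leq s ->
  exists2 j, j.+1 < size s & nth 0 s j.+1 < nth 0 s j.
Proof.
move=> unsorted.
have /allPn[j] : ~~ all (fun j => nth 0 s j <= nth 0 s j.+1) (iota 0 (size s).-1).
  apply: contra unsorted => /allP H; apply/(sortedP 0) => j lt_j.
  by apply: H; rewrite mem_iota; lia.
by rewrite mem_iota -ltnNge => lt_j; exists j => //; lia.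
Qed.

(** If [s] is not weakly increasing, then the cut is at its only descent. *)
Lemma cut_uniq c d s : cut c s -> cut d s -> ~~ sorted leq s -> c = d.
Proof.
move=> /cutP Hc /cutP Hd /unsortedP[j lt_j gt_j].
have /eqP <- : j.+1 == c by apply: contraLR gt_j => /eqP/(Hc _ lt_j); lia.
by apply/eqP; apply: contraLR gt_j => /eqP/(Hd _ lt_j); lia.
Qed.

Lemma one_descentP n (rho : {ffun 'I_n -> 'I_n}) :
  reflect ((exists c, cut c (ffun_word rho)) /\ ~~ sorted leq (ffun_word rho))
          (tieless rho && (#|descents rho| == 1)).
Proof.
set s := ffun_word rho; have sz : size s = n by apply: size_ffun_word.
apply: (iffP andP) => [[/tielessP tl /cards1P[i des_i]]|[[c /cutP Hc] unsorted]].
  have /[!mem_descents]/andP[lt_i gt_i] : i \in descents rho by rewrite des_i inE.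
  split; last first.
    by apply/negP => /(sortedP 0)/(_ i); rewrite sz => /(_ lt_i); rewrite leqNgt gt_i.
  exists i.+1; apply/cutP => j; rewrite sz => lt_j ne_ji.
  have /eqP ne_j := tl j lt_j; rewrite -/s in ne_j.
  rewrite ltn_neqAle ne_j /= leqNgt; apply/negP => gt_j.
  have : Ordinal (ltnW lt_j) \in descents rho by rewrite mem_descents /= lt_j.
  by rewrite des_i inE => /eqP/(congr1 val)/= eq_ji; apply: ne_ji; rewrite eq_ji.
have [i] := unsortedP unsorted; rewrite sz => lt_i gt_i.
have def_c : i.+1 = c.
  by apply/eqP; apply: contraLR gt_i => /eqP; rewrite -sz in lt_i => /(Hc _ lt_i); lia.
split.
  apply/tielessP => j lt_j eq_j; have [eq_ji|/eqP ne_ji] := eqVneq j i.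
    by move: gt_i; rewrite -/s eq_ji in eq_j; rewrite eq_j ltnn.
  have := Hc j; rewrite sz eq_j ltnn => H; suff: false by []; apply: H => //.
  by rewrite -def_c => -[].
apply/cards1P; exists (Ordinal (ltnW lt_i)); apply/setP => j.
rewrite mem_descents inE -val_eqE /=.
apply/andP/eqP => [[lt_j gt_j]|->]; last by [].
apply/eqP; apply: contraLR gt_j => /eqP ne_ji.
by rewrite -leqNgt ltnW // Hc ?sz // -def_c => -[].
Qed.

(** * The bijection between functions and words *)

Lemma run_inj b c k : size b = size c -> run b k = run c k -> b = c.
Proof.
elim: b c k => [|x b IHb] [|y c] //= k [sz]; rewrite !run_cons.
have notin d : k \notin run d k.+1.
  by apply/negP => /(allP (run_ge _ _)); rewrite /= ltnn.
case: x y => [] [] /= => [[]|eq_bc|eq_bc|].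
- by move/(IHb _ _ sz) ->.
- by have := notin c; rewrite -eq_bc mem_head.
- by have := notin b; rewrite eq_bc mem_head.
- by move/(IHb _ _ sz) ->.
Qed.

(** A strictly increasing sequence is the run of its membership bits. *)
Lemma run_mem n s : sorted ltn s -> all (gtn n) s ->
  run [seq x \in s | x <- iota 0 n] 0 = s.
Proof.
move=> sorted_s lt_s; rewrite /run size_map size_iota -filter_mask.
apply: (irr_sorted_eq ltn_trans ltnn) => //.
  by apply: sorted_filter; [exact: ltn_trans | exact: iota_ltn_sorted].
move=> x; rewrite mem_filter mem_iota /= add0n andb_idr // => /(allP lt_s).
by [].
Qed.

Lemma two_runs_lt n w : size w = n -> all (gtn n) (two_runs 0 w).
Proof.
move=> sz; rewrite all_cat /run !size_map sz.
by apply/andP; split; apply/allP => x /mem_mask; rewrite mem_iota.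
Qed.

Lemma cut_two_runs w : cut (count fst w) (two_runs 0 w).
Proof.
rewrite -(count_map fst id) -(size_run (unzip1 w) 0) /cut.
by rewrite take_size_cat // drop_size_cat // !run_sorted.
Qed.

(** Decoding the two runs of a word is a bijection onto the tieless parking
    functions with one descent; the inverse cuts a function at its descent. *)
Lemma card_one_descent n :
  #|tieless_parking_des n 1%R| =
  nb_words n (fun w => motzkin 0 w && ~~ sorted leq (two_runs 0 w)).
Proof.
pose F (w : n.-tuple letter) := ffun_of_word n (two_runs 0 w).
pose P := [set w : n.-tuple letter | motzkin 0 w && ~~ sorted leq (two_runs 0 w)].
have FK w : w \in P -> ffun_word (F w) = two_runs 0 w.
  rewrite inE motzkin_parking size_tuple => /andP[/andP[/eqP sz _] _].
  by rewrite ffun_of_wordK // two_runs_lt // size_tuple.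
have injF : {in P &, injective F}.
  move=> w v Pw Pv /(congr1 (@ffun_word n)); rewrite !FK // => eq_wv.
  have unsorted : ~~ sorted leq (two_runs 0 w) by move: Pw; rewrite inE => /andP[].
  (* The common sequence of values determines the cut, hence both runs. *)
  have eq_cut : count fst w = count fst v.
    by apply: (cut_uniq (cut_two_runs w)) => //; rewrite eq_wv cut_two_runs.
  move/eqP: eq_wv; rewrite eqseq_cat ?size_run ?count_map //.
  case/andP=> /eqP eq1 /eqP eq2; apply: val_inj.
  rewrite /= -(zip_unzip w) -(zip_unzip v).
  have szE (f : letter -> bool) : size (map f w) = size (map f v).
    by rewrite !size_map !size_tuple.
  by congr zip; [apply: run_inj (szE _) eq1 | apply: run_inj (szE _) eq2].
transitivity #|F @: P|; last by rewrite (card_in_imset injF).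
apply: eq_card => rho; rewrite inE eqz_nat.
apply/and3P/imsetP => [[park tl d1]|[w Pw ->]]; last first.
  have := Pw; rewrite inE motzkin_parking size_tuple => /andP[park unsorted].
  rewrite parking_ffun_word FK //.
  suff /andP[-> ->] : tieless (F w) && (#|descents (F w)| == 1) by [].
  apply/one_descentP; rewrite FK //; split=> //.
  by exists (count fst w); apply: cut_two_runs.
have /one_descentP[[c /andP[s1 s2]] unsorted] :
  tieless rho && (#|descents rho| == 1) by rewrite tl.
set s := ffun_word rho in s1 s2 unsorted.
(* The letter for the value x records its membership in each of the two runs. *)
have lt_s : all (gtn n) (take c s ++ drop c s) by rewrite cat_take_drop ffun_word_lt.
move: lt_s; rewrite all_cat => /andP[lt1 lt2].
pose b (r : seq nat) := [seq x \in r | x <- iota 0 n].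
have szb r : size (b r) = n by rewrite size_map size_iota.
have szw : size (zip (b (take c s)) (b (drop c s))) == n.
  by rewrite size_zip !szb minnn.
pose w := Tuple szw.
have two_w : two_runs 0 w = s.
  by rewrite /two_runs /= unzip1_zip ?unzip2_zip ?szb // !run_mem // cat_take_drop.
exists w; last by rewrite /F two_w ffun_wordK.
by rewrite inE motzkin_parking size_tuple two_w -parking_ffun_word park.
Qed.

(** * Reading a function backwards *)

(** The function [rho] read from right to left. *)
Definition rev_ffun n (rho : {ffun 'I_n -> 'I_n}) : {ffun 'I_n -> 'I_n} :=
  [ffun i => rho (rev_ord i)].

Lemma rev_ffunK n : involutive (@rev_ffun n).
Proof. by move=> rho; apply/ffunP => i; rewrite !ffunE rev_ordK. Qed.

Lemma ffun_word_rev n (rho : {ffun 'I_n -> 'I_n}) :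
  ffun_word (rev_ffun rho) = rev (ffun_word rho).
Proof.
apply: (@eq_from_nth _ 0) => [|i]; rewrite ?size_rev !size_ffun_word // => lt_in.
rewrite nth_rev ?size_ffun_word // (nth_ffun_word _ (Ordinal lt_in)) ffunE.
by rewrite -nth_ffun_word.
Qed.

Lemma parking_rev n (rho : {ffun 'I_n -> 'I_n}) :
  parking (rev_ffun rho) = parking rho.
Proof.
rewrite !parking_ffun_word ffun_word_rev /parking_word size_rev.
by congr (_ && _); apply: eq_all => k; rewrite count_rev.
Qed.

Lemma tieless_rev n (rho : {ffun 'I_n -> 'I_n}) :
  tieless rho -> tieless (rev_ffun rho).
Proof.
move=> /tielessP tl; apply/tielessP => i lt_in; rewrite ffun_word_rev.
rewrite !nth_rev ?size_ffun_word //; last exact: ltnW.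
have := tl (n - i.+2); rewrite -subSn // subSS => H /esym; apply: H; lia.
Qed.

(** The sum stops before the last position, which is never a descent. *)
Lemma card_descents m (rho : {ffun 'I_m.+1 -> 'I_m.+1}) :
  #|descents rho| =
  \sum_(0 <= i < m) (nth 0 (ffun_word rho) i.+1 < nth 0 (ffun_word rho) i).
Proof.
rewrite -sum1_card big_mkcond /= big_ord_recr /= mem_descents ltnn addn0 big_mkord.
apply: eq_bigr => i _; rewrite mem_descents /= ltnS ltn_ord /=.
by case: ifP.
Qed.

(** Descents of the reversed function are ascents of the original one, and
    without ties each of the [m] positions is one or the other. *)
Lemma card_descents_rev m (rho : {ffun 'I_m.+1 -> 'I_m.+1}) :
  tieless rho -> #|descents (rev_ffun rho)| + #|descents rho| = m.
Proof.
move=> /tielessP tl; rewrite !card_descents ffun_word_rev big_nat_rev /= add0n.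
rewrite -big_split /= -[RHS]subn0 -[RHS]muln1 -sum_nat_const_nat.
apply: eq_big_nat => i /andP[_ lt_im].
rewrite !nth_rev ?size_ffun_word; try lia.
rewrite (_ : m.+1 - (m - i.+1).+2 = i); last by lia.
rewrite (_ : m.+1 - (m - i.+1).+1 = i.+1); last by lia.
have := tl i; rewrite ltnS lt_im => /(_ isT); lia.
Qed.

Lemma card_tieless_parking_des_rev m (d : nat) : d <= m ->
  #|tieless_parking_des m.+1 d%:Z| = #|tieless_parking_des m.+1 (m - d)%:Z|.
Proof.
move=> le_dm; rewrite -(card_imset _ (can_inj (@rev_ffunK m.+1))).
apply: eq_card => rho; rewrite inE; apply/imsetP/idP => [[s + ->]|].
  rewrite inE => /and3P[park tl des]; rewrite parking_rev park tieless_rev //=.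
  apply/eqP; congr Posz; case/eqP: des => des; apply: (@addIn #|descents s|).
  by rewrite card_descents_rev // des subnK.
case/and3P=> park tl des; exists (rev_ffun rho); last by rewrite rev_ffunK.
rewrite inE parking_rev park tieless_rev //=.
apply/eqP; congr Posz; case/eqP: des => des; apply: (@addIn #|descents rho|).
by rewrite card_descents_rev // des subnKC.
Qed.

(** * The Catalan number and the conclusion *)

Lemma catalanE n : (catalan n.+1 = 'C(n.*2, n)%:R - 'C(n.*2, n.+2)%:R :> rat)%R.
Proof.
have nz : (n.+2%:R != 0 :> rat)%R by rewrite pnatr_eq0.
have key : n.+2 * 'C(n.*2, n) = 'C(n.+1.*2, n.+1) + n.+2 * 'C(n.*2, n.+2).
  case: n {nz} => [|n] //.
  have := mul_bin_left n.+1.*2 n.+1; have := mul_bin_left n.+1.*2 n.+2.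
  have -> : n.+1.*2 - n.+1 = n.+1 by lia.
  have -> : n.+1.*2 - n.+2 = n by lia.
  rewrite (bin_double_rec n.+1 n) (bin_double_sym n).
  move: 'C(_, n.+1) 'C(_, n.+2) 'C(_, n.+3) => a b c; lia.
rewrite /catalan; apply: (mulIf nz); rewrite mulfVK // mulrBl -!natrM.
by rewrite ![(_ * n.+2)%N]mulnC key natrD addrK.
Qed.

Local Open Scope ring_scope.

Theorem corollary1p2 (n : nat) (hn : (1 <= n)%N) :
  (#|tieless_parking_des n 1|%:R : rat) = catalan n.+1 - 'C(n.+1, 2)%:R - 1
  /\
  (#|tieless_parking_des n (n%:Z - 2)|%:R : rat)
    = catalan n.+1 - 'C(n.+1, 2)%:R - 1.
Proof.
have one : (#|tieless_parking_des n 1|%:R : rat) =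
    catalan n.+1 - 'C(n.+1, 2)%:R - 1.
  rewrite catalanE card_one_descent.
  have := nb_motzkin n 0; rewrite addn0 => <-.
  rewrite -(nb_words_split n (motzkin 0) (fun w => sorted leq (two_runs 0 w))).
  by rewrite nb_motzkin_sorted !natrD; ring.
split=> //; rewrite -one; congr _%:R.
case: n hn {one} => [|[|m]] // _; last first.
  have -> : m.+2%:Z - 2 = m%:Z by lia.
  by rewrite (card_tieless_parking_des_rev (leqnSn m)) subSnn.
(* In length 1 there is no descent, and n - 2 is negative. *)
rewrite !eq_card0 // => rho; rewrite inE.
  by rewrite card_descents big_geq // !andbF.
by rewrite !andbF.
Qed.
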